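(* For every partition $\lambda$, $$s_\lambda=\sum_{\alpha:\ \bm{\lambda}(\alpha)=\lambda'}\mathcal{RS}_\alpha,$$ where the sum is over all compositions $\alpha$ whose parts rearrange to the conjugate partition $\lambda'$ of $\lambda$.
   Context: Here $s_\lambda=s_\lambda(x_1,x_2,\ldots)$ is the Schur function, $\lambda'$ is the conjugate (transpose) partition, and for a composition $\alpha$ (finite sequence of positive integers), $\bm{\lambda}(\alpha)$ is the partition obtained by arranging the parts of $\alpha$ in weakly decreasing order. The diagram of $\alpha=(\alpha_1,\ldots,\alpha_l)$ has $l$ rows of left-justified cells, the $i$-th row from the top having $\alpha_i$ cells. Let $m$ be the largest part of $\alpha$. A row-strict composition tableau (RSCT) $F$ of shape $\alpha$ is a filling of the diagram with positive integers such that (1) entries strictly decrease in each row from left to right; (2) entries in the leftmost column weakly increase from top to bottom; (3) if $\hat F$ is the $l\times m$ array obtained from $F$ by adding cells with entry $0$ to the end of each row, then for $1\le i<j\le l$, $2\le k\le m$: $\hat F(j,k)>\hat F(i,k)$ implies $\hat F(j,k)\ge\hat F(i,k-1)$ (where $\hat F(i,j)$ is the entry in row $i$, column $j$). The weight is $x^F=\prod_i x_i^{w_i(F)}$ with $w_i(F)$ the number of occurrences of $i$ in $F$, and $\mathcal{RS}_\alpha=\sum_F x^F$ over all RSCTs $F$ of shape $\alpha$. *)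

(* Defs.v *)
From mathcomp Require Import all_boot all_order all_algebra finmap.
From mathcomp Require Export boolp classical_sets functions cardinality fsbigop.

Set Implicit Arguments.
Unset Strict Implicit.
Unset Printing Implicit Defensive.

Import GRing.Theory.

Local Open Scope classical_set_scope.
Local Open Scope ring_scope.

(* An exponent vector w stands for the monomial \prod_i x_i ^ (w i).  Entries
   of tableaux are positive, so x_0 never occurs in the series below. *)
Definition exponent : choiceType := {fsfun nat -> nat with 0%N}.

(* Formal power series over the integers in infinitely many variables, given by
   their coefficients; addition is the pointwise one of the function type. *)
Notation series := (exponent -> int).

Definition monomial (w : exponent) : series := fun u => (u == w)%:R.

(* Possibly infinite sums of monomials are taken coefficientwise.  The finitely
   supported sum has junk value 0 when infinitely many terms are nonzero; this
   does not occur below, see finite_filling_weight. *)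
Definition generating_series (T : choiceType) (A : set T) (wt : T -> exponent) :
    series :=
  fun u => \sum_(t \in A) monomial (wt t) u.

Definition is_composition (al : seq nat) : bool := 0%N \notin al.

Definition is_partition (la : seq nat) : bool :=
  is_composition la && sorted geq la.

Definition partition_of (al : seq nat) : seq nat := sort geq al.

Definition conjugate (la : seq nat) : seq nat :=
  [seq count (fun p => (j < p)%N) la | j <- iota 0 (\max_(p <- la) p)].

(* A filling is the sequence of its rows, from top to bottom; its diagram is
   recorded by [shape], the sequence of its row lengths. *)
Notation filling := (seq (seq nat)).

(* Rows and columns are numbered from 0.  Cells outside the diagram have entry
   0, so this is also the padded array \hat F. *)
Definition entry (F : filling) (i k : nat) : nat :=
  nth 0%N (nth [::] F i) k.

Definition positive_filling (F : filling) : bool := 0%N \notin flatten F.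

Definition weight (F : filling) : exponent :=
  [fsfun i in [fset j in flatten F]%fset => count_mem i (flatten F)].

Definition semistandard (la : seq nat) (T : filling) : Prop :=
  [/\ shape T = la,
      positive_filling T,
      all (sorted leq) T
    & forall i k, (i.+1 < size la)%N -> (k < nth 0%N la i.+1)%N ->
        (entry T i k < entry T i.+1 k)%N].

Definition schur (la : seq nat) : series :=
  generating_series [set T | semistandard la T] weight.

Definition rsct (al : seq nat) (F : filling) : Prop :=
  [/\ shape F = al,
      positive_filling F,
      all (sorted gtn) F,
      sorted leq [seq head 0%N r | r <- F]
    & forall i j k, (i < j < size al)%N -> (0 < k < \max_(a <- al) a)%N ->
        (entry F j k > entry F i k)%N -> (entry F j k >= entry F i k.-1)%N].

Definition RS (al : seq nat) : series :=
  generating_series [set F | rsct al F] weight.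

Lemma weightE F i : weight F i = count_mem i (flatten F).
Proof.
rewrite /weight fsfunE in_fset; case: ifPn => // /count_memPn H.
by rewrite H.
Qed.

Lemma finite_filling_weight (al : seq nat) (w : exponent) :
  finite_set [set F | shape F = al /\ weight F = w].
Proof.
case: (pselect (exists F, shape F = al /\ weight F = w)) => [[G [_ wG]]|H].
  apply: (@sub_finite_set _ _
    [set` [seq reshape al s | s <- permutations (flatten G)]]).
    move=> F /= [sF wF]; apply/mapP; exists (flatten F).
      rewrite mem_permutations; apply/allP => i _ /=.
      by rewrite -!weightE wF wG.
    by rewrite -sF flattenK.
  exact: finite_seq.
apply: (@sub_finite_set _ _ set0) => // F /= HF.
by case: H; exists F.
Qed.

Lemma finite_rearrangements (mu : seq nat) :
  finite_set [set al | is_composition al /\ partition_of al = mu].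
Proof.
apply: (@sub_finite_set _ _ [set` permutations mu]); last exact: finite_seq.
move=> al /= [_ <-]; rewrite mem_permutations.
by rewrite /partition_of perm_sym perm_sort.
Qed.

(* Main.v *)
Require Import Defs.
From mathcomp Require Import all_boot all_order all_algebra finmap.
From mathcomp Require Import zify.

Set Implicit Arguments.
Unset Strict Implicit.
Unset Printing Implicit Defensive.

(** The two sides are compared coefficientwise: fix a monomial with exponents
    ws on x_1, x_2, and so on, and count the tableaux of that content.

    Both kinds of tableaux are built from sequences of horizontal strips.  If
    [strips_of ka a] lists the partitions r with ka / r a horizontal strip of
    size a, then [kostka ka ws] counts the ways of going down from ka to the
    empty partition by strips of sizes ws.

    - Removing the largest entry of a semistandard tableau of shape ka removes a
      horizontal strip, and any strip can be put back in one way.  The contents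
      are consumed from the last one, so the count is [kostka ka (rev ws)]
      ([ssyt_counted]).

    - For row-strict composition tableaux, the shape enters only through the
      numbers [above k F] of rows of length more than k; saying that the
      shape rearranges to the conjugate of ka is saying that these numbers are
      the parts of ka ([rearrangementP]).  Removing the smallest entry from
      such a tableau F, that is, erasing the entries 1 and lowering the others,
      shortens some rows by one cell, so it turns ka into some r with ka / r a
      horizontal strip.  Conversely, given r, the number of rows of each length
      that have to receive a 1 is known, and the third tableau condition says
      exactly that they are the topmost rows of that length ([compatible_up]);
      the new rows consisting of a single 1 come first by the condition on the
      leftmost column.  So there is one way back, and the count is
      [kostka ka ws] ([rsct_cols_counted]).

    The two counts agree because [kostka] is symmetric ([kostka_rev]).  Its
    invariance under exchanging two consecutive strip sizes is the
    Bender-Knuth involution in terms of Gelfand-Tsetlin patterns: with ka and nu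
    fixed, each part of an intermediate partition ranges freely in an interval,
    and reflecting every part in its interval exchanges the two strip sizes
    ([sumn_reflect_strip]). *)

(** * Horizontal strips and the symmetry of their iterated count *)

(** The partitions r, padded with zeros to the length of ka, such that ka / r is a
    horizontal strip.  The list is empty when ka is not weakly decreasing. *)
Fixpoint strips (ka : seq nat) : seq (seq nat) :=
  if ka is x :: ka' then
    [seq y :: r | y <- iota (head 0 ka') (x.+1 - head 0 ka'), r <- strips ka']
  else [:: [::]].

Lemma mem_strips ka r :
  reflect (size r = size ka /\
           forall j, nth 0 ka j.+1 <= nth 0 r j <= nth 0 ka j)
          (r \in strips ka).
Proof.
apply: (iffP idP).
  elim: ka r => [|x ka IH] r /=.
    by rewrite inE => /eqP ->; split=> // j; rewrite !nth_nil.
  case/allpairsP => -[y r'] /= [Hy /IH [szr Hr] ->] /=; split; first by rewrite szr.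
  by case=> [|j] /=; [move: Hy; rewrite mem_iota nth0; lia | exact: Hr].
elim: ka r => [|x ka IH] [|y r] [] //= [szr] Hr.
apply: allpairs_f.
  by move: (Hr 0); rewrite mem_iota /= nth0; lia.
by apply: IH; split=> // j; exact: (Hr j.+1).
Qed.

Lemma uniq_strips ka : uniq (strips ka).
Proof.
elim: ka => //= x ka IH.
apply: allpairs_uniq => //; first exact: iota_uniq.
by move=> [a b] [c d] _ _ /= [-> ->].
Qed.

Definition strips_of (ka : seq nat) (a : nat) : seq (seq nat) :=
  [seq r <- strips ka | sumn ka == sumn r + a].

(** For a partition ka and ws of any order, this is the Kostka number of ka and
    ws. *)
Fixpoint kostka (ka ws : seq nat) : nat :=
  if ws is a :: ws' then \sum_(r <- strips_of ka a) kostka r ws'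
  else (sumn ka == 0).

(** When r lies between ka and nu with two horizontal strips, its part r_j
    ranges in the interval from max(nu_j, ka_{j+1}) to min(ka_j, nu_{j-1}),
    independently of the other parts; each part is reflected in its interval.
    The interval of the first part is bounded above by ka_0 only. *)
Definition reflect_strip (ka nu r : seq nat) : seq nat :=
  mkseq (fun j => maxn (nth 0 nu j) (nth 0 ka j.+1)
                  + (if j is i.+1 then minn (nth 0 ka j) (nth 0 nu i)
                     else nth 0 ka 0) - nth 0 r j) (size ka).

Lemma sumn_nth n (l : seq nat) :
  size l <= n -> sumn l = \sum_(0 <= j < n) nth 0 l j.
Proof.
elim: n l => [|n IH] [|x l] //= Hl; first by rewrite big_nil.
  by rewrite big1 // => i _; rewrite nth_nil.
by rewrite big_nat_recl //= IH.
Qed.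

Lemma size_reflect_strip ka nu r : size (reflect_strip ka nu r) = size ka.
Proof. exact: size_mkseq. Qed.

Lemma nth_reflect_strip ka nu r j :
  r \in strips ka -> nu \in strips r ->
  nth 0 (reflect_strip ka nu r) j =
  maxn (nth 0 nu j) (nth 0 ka j.+1)
    + (if j is i.+1 then minn (nth 0 ka j) (nth 0 nu i) else nth 0 ka 0)
    - nth 0 r j.
Proof.
move=> /mem_strips [szr Hr] /mem_strips [szn Hn].
have [lt_j|ge_j] := ltnP j (size ka); first by rewrite nth_mkseq.
rewrite (nth_default _ (_ : size (reflect_strip ka nu r) <= j)) ?size_mkseq //.
move: (Hr j) (Hn j); rewrite (nth_default _ ge_j) => hr hn.
by case: j ge_j hr hn => [|j] ge_j hr hn; rewrite ?(nth_default _ ge_j); lia.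
Qed.

Lemma reflect_strip_mem ka nu r :
  r \in strips ka -> nu \in strips r ->
  (reflect_strip ka nu r \in strips ka) && (nu \in strips (reflect_strip ka nu r)).
Proof.
move=> Sr Sn; have nthR j := nth_reflect_strip j Sr Sn.
move: (Sr) (Sn) => /mem_strips [szr Hr] /mem_strips [szn Hn].
apply/andP; split; apply/mem_strips; split.
- exact: size_reflect_strip.
- move=> j; rewrite nthR; move: (Hr j) (Hn j).
  by case: j => [|j]; [|move: (Hr j) (Hn j)]; lia.
- by rewrite size_reflect_strip szn szr.
- move=> j; rewrite !nthR; move: (Hr j) (Hn j) (Hr j.+1) (Hn j.+1).
  by case: j => [|j]; [|move: (Hr j) (Hn j)]; lia.
Qed.

Lemma reflect_stripK ka nu r :
  r \in strips ka -> nu \in strips r ->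
  reflect_strip ka nu (reflect_strip ka nu r) = r.
Proof.
move=> Sr Sn; have /andP[Sr' Sn'] := reflect_strip_mem Sr Sn.
move: (Sr) (Sn) => /mem_strips [szr Hr] /mem_strips [szn Hn].
apply: (@eq_from_nth _ 0) => [|j _]; first by rewrite size_reflect_strip.
rewrite nth_reflect_strip // nth_reflect_strip //.
move: (Hr j) (Hn j).
by case: j => [|j]; [|move: (Hr j) (Hn j)]; lia.
Qed.

(** The end points of the intervals add up to |ka| + |nu|, since
    max(nu_j, ka_{j+1}) + min(ka_{j+1}, nu_j) = nu_j + ka_{j+1}.  So if r cuts
    ka / nu into strips of sizes a and b, its reflection cuts it into strips of
    sizes b and a. *)
Lemma sumn_reflect_strip ka nu r :
  r \in strips ka -> nu \in strips r ->
  sumn (reflect_strip ka nu r) + sumn r = sumn ka + sumn nu.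
Proof.
move=> Sr Sn; have nthR j := nth_reflect_strip j Sr Sn.
move: (Sr) (Sn) => /mem_strips [szr Hr] /mem_strips [szn Hn].
rewrite !(@sumn_nth (size ka)) ?size_reflect_strip ?szn ?szr //.
have: nth 0 nu (size ka) = 0 by rewrite nth_default // szn szr.
have: nth 0 ka (size ka) = 0 by rewrite nth_default.
rewrite -!big_split /=.
under eq_bigr => j _.
  have -> : nth 0 (reflect_strip ka nu r) j + nth 0 r j =
    maxn (nth 0 nu j) (nth 0 ka j.+1) +
    (if j is i.+1 then minn (nth 0 ka j) (nth 0 nu i) else nth 0 ka 0).
    rewrite nthR; move: (Hr j) (Hn j).
    by case: j => [|j]; [|move: (Hr j) (Hn j)]; lia.
  over.
(* telescoping: maxn a b + minn a b = a + b across consecutive positions *)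
have tele n : \sum_(0 <= j < n) (maxn (nth 0 nu j) (nth 0 ka j.+1) +
    (if j is i.+1 then minn (nth 0 ka j) (nth 0 nu i) else nth 0 ka 0))
  + (if n is i.+1 then minn (nth 0 ka n) (nth 0 nu i) else nth 0 ka 0) =
  \sum_(0 <= j < n) (nth 0 ka j + nth 0 nu j) + nth 0 ka n.
  elim: n => [|n IH]; first by rewrite !big_nil.
  by rewrite !big_nat_recr //=; lia.
by move: (tele (size ka)); case: (size ka) => [|n]; rewrite ?big_nil //; lia.
Qed.

(** The reflection is a bijection between the pairs (r, nu) that contribute to the
    two sides, and it keeps nu. *)
Lemma kostka_swap ka a b ws : kostka ka [:: a, b & ws] = kostka ka [:: b, a & ws].
Proof.
pose pairs a b := [seq (r, nu) | r <- strips_of ka a, nu <- strips_of r b].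
have sum_pairs c d : kostka ka [:: c, d & ws] = \sum_(x <- pairs c d) kostka x.2 ws.
  by rewrite /= (big_allpairs_dep (op := addn)).
have mem_pairs c d r nu : ((r, nu) \in pairs c d) =
    [&& r \in strips ka, nu \in strips r,
        sumn ka == sumn r + c & sumn r == sumn nu + d].
  apply/allpairsPdep/idP => [[r' [nu' [+ + [-> ->]]]]|].
    by rewrite !mem_filter => /andP[-> ->] /andP[-> ->].
  by case/and4P=> *; exists r, nu; rewrite !mem_filter; split=> //; apply/andP.
have uniq_pairs c d : uniq (pairs c d).
  apply: allpairs_uniq_dep; first exact/filter_uniq/uniq_strips.
    by move=> *; exact/filter_uniq/uniq_strips.
  by move=> [x y] [z t] _ _ /= [-> ->].
pose f (x : seq nat * seq nat) := (reflect_strip ka x.2 x.1, x.2).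
have fP c d x : x \in pairs c d -> f x \in pairs d c /\ f (f x) = x.
  case: x => r nu; rewrite !mem_pairs /= => /and4P[Sr Sn /eqP e1 /eqP e2].
  have /andP[-> ->] /= := reflect_strip_mem Sr Sn.
  rewrite /f /= reflect_stripK //; split=> //.
  by move: (sumn_reflect_strip Sr Sn); lia.
rewrite !sum_pairs -[RHS](big_map f predT (fun x => kostka x.2 ws)).
apply: perm_big; apply: uniq_perm => //.
  rewrite map_inj_in_uniq // => x y /fP [_ fx] /fP [_ fy] e.
  by rewrite -fx -fy e.
move=> x; apply/idP/mapP => [/fP [Hf ff]|[y /fP [Hf _] ->] //].
by exists (f x).
Qed.

Lemma kostka_rcons ka a ws : kostka ka (a :: ws) = kostka ka (rcons ws a).
Proof.
elim: ws ka => // b ws IH ka.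
by rewrite kostka_swap /=; apply: eq_bigr => r _; rewrite -IH.
Qed.

Lemma kostka_rev ka ws : kostka ka (rev ws) = kostka ka ws.
Proof.
elim: ws ka => // a ws IH ka.
by rewrite rev_cons -kostka_rcons /=; apply: eq_bigr => r _; rewrite IH.
Qed.

(** * Counting by peeling off an extreme entry *)

(** An enumeration is used in place of a cardinal, so that no finiteness of the
    sets of tableaux has to be proved beforehand. *)
Definition counted (T : eqType) (A : T -> Prop) (m : nat) : Prop :=
  exists s : seq T, [/\ uniq s, forall x, A x <-> x \in s & size s = m].

Lemma counted_fibers (I T : eqType) (s : seq I) (B : I -> T -> Prop)
    (m : I -> nat) :
  uniq s ->
  {in s &, forall i j x, B i x -> B j x -> i = j} ->
  {in s, forall i, counted (B i) (m i)} ->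
  counted (fun x => exists2 i, i \in s & B i x) (\sum_(i <- s) m i).
Proof.
elim: s => [|i s IH] /=.
  move=> _ _ _; exists [::]; rewrite big_nil; split=> // x.
  by split=> // -[].
case/andP=> i_s Us disj cB.
have sub j : j \in s -> j \in i :: s by rewrite inE orbC => ->.
have [t [Ut tP szt]] := IH Us (sub_in2 sub disj) (sub_in1 sub cB).
have [u [Uu uP szu]] := cB i (mem_head _ _).
exists (u ++ t); split; last by rewrite size_cat szu szt big_cons.
  rewrite cat_uniq Uu Ut andbT /=; apply/hasPn => x /tP [j js Bj].
  apply/negP => /uP Bi; move: i_s.
  by rewrite (disj i j _ _ x) ?js // inE ?eqxx ?js ?orbT.
move=> x; rewrite mem_cat.
split=> [[j + Bj]|/orP[/uP Bi|/tP [j js Bj]]]; last first.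
- by exists j; rewrite // inE js orbT.
- by exists i; rewrite ?mem_head.
rewrite inE => /orP[/eqP ji|js]; apply/orP; [left|right].
  by apply/uP; rewrite -ji.
by apply/tP; exists j.
Qed.

Lemma counted_bij (T : eqType) (A B : T -> Prop) (m : nat)
    (peel grow : T -> T) :
  (forall x, A x -> B (peel x) /\ grow (peel x) = x) ->
  (forall y, B y -> A (grow y) /\ peel (grow y) = y) ->
  counted B m -> counted A m.
Proof.
move=> AB BA [s [Us sP <-]]; exists (map grow s); split; last exact: size_map.
  rewrite map_inj_in_uniq // => x y /sP /BA [_ ex] /sP /BA [_ ey] e.
  by rewrite -ex -ey e.
move=> x; split=> [/AB [/sP Bx <-]|/mapP [y /sP /BA [Ax _] -> //]].
exact: map_f.
Qed.

(** Entries are positive, so the multiplicity of i.+1 is recorded at position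
    i. *)
Definition content (s ws : seq nat) : Prop :=
  forall i, count_mem i.+1 s = nth 0 ws i.

Lemma content_nil s : 0 \notin s -> content s [::] -> s = [::].
Proof.
case: s => // x s; rewrite inE => /norP[x0 _] /(_ x.-1).
by rewrite nth_nil prednK ?lt0n 1?eq_sym //= eqxx.
Qed.

Lemma content_le s ws : content s ws -> all (fun x => x <= size ws) s.
Proof.
move=> sP; apply/allP => -[|x] //= xs; rewrite ltnNge; apply/negP => le_x.
by move: xs; rewrite -has_pred1 has_count sP nth_default.
Qed.

(** Effect on the content of removing the largest possible entry. *)
Lemma content_rcons s v a :
  content s (rcons v a) <->
  [/\ all (fun x => x <= (size v).+1) s,
      content [seq x <- s | x <= size v] v
    & size s = size [seq x <- s | x <= size v] + a].
Proof.
have top : all (fun x => x <= (size v).+1) s ->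
    size s = size [seq x <- s | x <= size v] + count_mem (size v).+1 s.
  move=> /allP le_s; rewrite size_filter -(count_predC (fun x => x <= size v) s).
  congr (_ + _); apply: eq_in_count => x /le_s /=; lia.
have low i : i < size v ->
    count_mem i.+1 [seq x <- s | x <= size v] = count_mem i.+1 s.
  move=> lt_i; rewrite count_filter; apply: eq_count => x /=.
  by case: eqP => // ->; rewrite lt_i.
split=> [sP|[le_s vP sz] i].
  have le_s := content_le sP; rewrite size_rcons in le_s; split=> //.
    move=> i; have [lt_i|ge_i] := ltnP i (size v).
      by rewrite low // sP nth_rcons lt_i.
    rewrite nth_default //; apply/count_memPn; rewrite mem_filter.
    by rewrite ltnNge ge_i.
  by rewrite (top le_s) sP nth_rcons ltnn eqxx.
have [lt_i|gt_i|->] := ltngtP i (size v).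
- by rewrite -low // vP nth_rcons lt_i.
- rewrite nth_default ?size_rcons //; apply/count_memPn/negP => /(allP le_s).
  by rewrite ltnS leqNgt gt_i.
- by rewrite nth_rcons ltnn eqxx; move: (top le_s); lia.
Qed.

Definition down (r : seq nat) : seq nat := [seq x.-1 | x <- r & 1 < x].

(** Effect on the content of removing the smallest possible entry and lowering
    the other ones. *)
Lemma content_cons s v a :
  0 \notin s ->
  content s (a :: v) <-> content (down s) v /\ size s = size (down s) + a.
Proof.
move=> s0.
have cnt i : count_mem i.+1 (down s) = count_mem i.+2 s.
  rewrite count_map count_filter; apply: eq_count => x /=; lia.
have sz : size s = size (down s) + count_mem 1 s.
  rewrite size_map size_filter -(count_predC (fun x => 1 < x) s).
  congr (_ + _); apply: eq_in_count => -[|[|x]] xs //.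
  by rewrite xs in s0.
split=> [sP|[sP e] [|i]].
- by split=> [i|]; rewrite ?cnt ?sz sP.
- by apply: (@addnI (size (down s))); rewrite -sz e.
- by rewrite -cnt sP.
Qed.

(** * Semistandard tableaux: removing the largest entry *)

Definition col_strict (r s : seq nat) : bool :=
  (size s <= size r) && all (fun k => nth 0 r k < nth 0 s k) (iota 0 (size s)).

Lemma col_strictP r s :
  reflect (size s <= size r /\ forall k, k < size s -> nth 0 r k < nth 0 s k)
          (col_strict r s).
Proof.
apply: (iffP andP) => -[le_sr rs]; split=> //.
  by move=> k lt_k; apply: (allP rs); rewrite mem_iota.
by apply/allP => k; rewrite mem_iota => /rs.
Qed.

(** The shape may have parts equal to 0, hence T empty rows: this keeps the number
    of rows constant when entries are removed.  Outside of the diagram the column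
    condition is void, so it can be stated for all rows. *)
Definition ssyt (ka ws : seq nat) (T : filling) : Prop :=
  [/\ shape T = ka, all (sorted leq) T,
      forall i, col_strict (nth [::] T i) (nth [::] T i.+1),
      0 \notin flatten T & content (flatten T) ws].

Definition remove_max (n : nat) (T : filling) : filling :=
  [seq [seq x <- r | x <= n] | r <- T].

Definition append_max (ka : seq nat) (n : nat) (T : filling) : filling :=
  mkseq (fun i => nth [::] T i ++ nseq (nth 0 ka i - size (nth [::] T i)) n.+1)
    (size ka).

Lemma sorted_append_max n r :
  sorted leq r -> all (fun x => x <= n.+1) r ->
  r = [seq x <- r | x <= n]
        ++ nseq (size r - size [seq x <- r | x <= n]) n.+1.
Proof.
elim: r => //= x r IH sr /andP[le_x le_r].
have [le_xn|lt_nx] := leqP x n; first by rewrite /= subSS -IH // (path_sorted sr).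
have r_big : all (pred1 n.+1) r.
  apply/allP => y yr /=; rewrite eqn_leq (allP le_r) //=.
  apply: leq_trans lt_nx _; move: sr; rewrite (path_sortedE leq_trans).
  by case/andP => /allP/(_ _ yr).
have -> : [seq x <- r | x <= n] = [::].
  by rewrite (all_pred1P _ _ r_big) filter_nseq ltnn.
by rewrite /= -(all_pred1P _ _ r_big); congr cons; apply/eqP; rewrite eqn_leq le_x.
Qed.

Lemma all_nth (T : Type) (P : pred T) (x0 : T) (s : seq T) i :
  P x0 -> all P s -> P (nth x0 s i).
Proof.
move=> Px0 Ps; have [lt_i|ge_i] := ltnP i (size s); last by rewrite nth_default.
exact: all_nthP.
Qed.

(** The column condition for the new entries says that the entries n.+1 of the
    lower row stop before those of the upper row start: the strip is
    horizontal. *)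
Lemma col_strict_append n r s m p :
  all (fun x => x <= n) r -> all (fun x => x <= n) s ->
  col_strict (r ++ nseq m n.+1) (s ++ nseq p n.+1) =
  col_strict r s && (size s + p <= size r).
Proof.
move=> le_r le_s.
have nth_app (q : seq nat) j k : k < size q + j ->
    nth 0 (q ++ nseq j n.+1) k = if k < size q then nth 0 q k else n.+1.
  move=> lt_k; rewrite nth_cat; case: ltnP => // le_k.
    by rewrite nth_nseq; case: ifP; lia.
have nth_le (q : seq nat) k : all (fun x => x <= n) q -> nth 0 q k <= n.
  exact: all_nth.
apply/col_strictP/andP; rewrite !size_cat !size_nseq.
  case=> le_sr rs.
  have fits k : k < size s + p -> k < size r.
    move=> lt_k; move: (rs k lt_k); rewrite !nth_app //; last by lia.
    have := nth_le s k le_s.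
    by case: (ltnP k (size r)); case: (ltnP k (size s)); lia.
  have le_all : size s + p <= size r.
    by case: (size s + p) fits => // k; apply.
  split=> //; apply/col_strictP; split=> [|k lt_k]; first by lia.
  by move: (rs k); rewrite !nth_app ?lt_k; [case: (ltnP k (size r)); lia|lia..].
case=> /col_strictP [le_sr rs] le_all; split=> [|k lt_k]; first by lia.
rewrite !nth_app //; last by lia.
rewrite (leq_trans lt_k le_all); case: (ltnP k (size s)) => [/rs //|_].
by have := nth_le r k le_r.
Qed.

Lemma nth_shape (F : filling) i : nth 0 (shape F) i = size (nth [::] F i).
Proof.
have [lt_i|ge_i] := ltnP i (size F); first by rewrite (nth_map [::]).
by rewrite !nth_default ?size_map.
Qed.

Lemma nth_remove_max n T i :
  nth [::] (remove_max n T) i = [seq x <- nth [::] T i | x <= n].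
Proof.
have [lt_i|ge_i] := ltnP i (size T); first by rewrite (nth_map [::]).
by rewrite !nth_default ?size_map.
Qed.

Lemma all_flattenP (P : pred nat) (F : filling) :
  all P (flatten F) <-> forall i, all P (nth [::] F i).
Proof.
have -> : all P (flatten F) = all (all P) F.
  by elim: F => //= r F <-; rewrite all_cat.
by split=> [PF i|PF]; [exact: all_nth|apply/(all_nthP [::]) => i _; exact: PF].
Qed.

Lemma all_sortedP (T : filling) :
  all (sorted leq) T <-> forall i, sorted leq (nth [::] T i).
Proof.
split=> [sT i|sT]; first exact: all_nth.
by apply/(all_nthP [::]) => i _; exact: sT.
Qed.

Lemma flatten_nil (T : eqType) (s : seq (seq T)) :
  flatten s = [::] -> s = nseq (size s) [::].
Proof. by elim: s => [|[|x r] s IH] //= /IH {1}->. Qed.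

(** The largest entry is removed first, so the last content comes first in the
    iterated count. *)
Lemma ssyt_counted ka ws : counted (ssyt ka (rev ws)) (kostka ka ws).
Proof.
elim: ws ka => [|a ws IH] ka /=.
  have [ka0|ka0] := eqVneq (sumn ka) 0; last first.
    exists [::]; split=> // T; split=> // -[shT _ _ T0 /(content_nil T0) flT].
    by move: ka0; rewrite -shT -size_flatten flT.
  have /natnseq0P ka_nseq : sumn ka == 0 by rewrite ka0.
  exists [:: nseq (size ka) [::]]; split=> // T; rewrite inE.
  split=> [[shT _ _ T0 /(content_nil T0) /flatten_nil ->]|/eqP ->].
    by rewrite -shT size_map.
  have flT : flatten (nseq (size ka) [::]) = [::] :> seq nat.
    by elim: (size ka).
  split; rewrite ?flT //; first by rewrite [RHS]ka_nseq /shape map_nseq.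
    by rewrite all_nseq orbT.
    by move=> i; rewrite !nth_nseq !if_same.
  by move=> i; rewrite nth_nil.
set n := size ws.
have rev_n : size (rev ws) = n by rewrite size_rev.
apply: (counted_bij (peel := remove_max n) (grow := append_max ka n)
  (B := fun T => exists2 r, r \in strips_of ka a & ssyt r (rev ws) T)).
- move=> T [shT sT cT T0]; rewrite rev_cons content_rcons rev_n => -[leT ctT szT].
  have Trow i := sorted_append_max ((all_sortedP T).1 sT i)
    ((all_flattenP _ _).1 leT i).
  have le_f i : size [seq x <- nth [::] T i | x <= n] <= size (nth [::] T i).
    by rewrite size_filter count_size.
  have cTrow i : col_strict [seq x <- nth [::] T i | x <= n]
                            [seq x <- nth [::] T i.+1 | x <= n]
      && (size (nth [::] T i.+1) <= size [seq x <- nth [::] T i | x <= n]).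
    have := cT i; rewrite (Trow i) (Trow i.+1) col_strict_append ?filter_all //.
    by rewrite subnKC // -!Trow.
  have TK : append_max ka n (remove_max n T) = T.
    apply: (@eq_from_nth _ [::]) => [|i]; first by rewrite size_mkseq -shT size_map.
    rewrite size_mkseq => lt_i; rewrite nth_mkseq // nth_remove_max.
    by rewrite -shT nth_shape -Trow.
  split=> //; exists (shape (remove_max n T)).
    rewrite mem_filter; apply/andP; split.
      by rewrite -shT -!size_flatten szT filter_flatten.
    apply/mem_strips; split=> [|j]; first by rewrite -shT !size_map.
    rewrite -shT !nth_shape nth_remove_max.
    by case/andP: (cTrow j) => _ ->; rewrite le_f.
  split=> //.
  + apply/all_sortedP => i; rewrite nth_remove_max.
    by rewrite sorted_filter ?(all_sortedP _).1 //; exact: leq_trans.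
  + by move=> i; rewrite !nth_remove_max; case/andP: (cTrow i).
  + by rewrite -filter_flatten mem_filter (negPf T0) andbF.
  + by rewrite -filter_flatten.
- move=> T [r]; rewrite mem_filter => /andP[/eqP sum_r /mem_strips [szr r_strip]].
  case=> shT sT cT T0 ctT.
  have leT := content_le ctT; rewrite rev_n in leT.
  have szT : size T = size ka by rewrite -(size_map size T) -szr -shT.
  have szTi i : size (nth [::] T i) = nth 0 r i by rewrite -shT nth_shape.
  have nth_app i : nth [::] (append_max ka n T) i =
      nth [::] T i ++ nseq (nth 0 ka i - size (nth [::] T i)) n.+1.
    have [lt_i|ge_i] := ltnP i (size ka); first by rewrite nth_mkseq.
    by rewrite !nth_default ?size_mkseq ?szT.
  have TK : remove_max n (append_max ka n T) = T.
    apply: (@eq_from_nth _ [::]) => [|i _]; first by rewrite size_map size_mkseq.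
    rewrite nth_remove_max nth_app filter_cat filter_nseq ltnn cats0.
    by apply/all_filterP; exact: (all_flattenP _ _).1.
  have shA : shape (append_max ka n T) = ka.
    apply: (@eq_from_nth _ 0) => [|i _]; first by rewrite size_map size_mkseq.
    rewrite nth_shape nth_app size_cat size_nseq szTi.
    by have := r_strip i; lia.
  split=> //; split=> //.
  + apply/all_sortedP => i; rewrite nth_app.
    rewrite (sorted_pairwise leq_trans) pairwise_cat -!(sorted_pairwise leq_trans).
    rewrite (all_sortedP T).1 //=; apply/andP; split; last first.
      by elim: (_ - _) => //= -[|m] //= ->; rewrite leqnn.
    apply/allrelP => x y xT; rewrite mem_nseq => /andP[_ /eqP ->].
    by apply: leqW; apply: (allP ((all_flattenP _ _).1 leT i)).
  + move=> i; rewrite !nth_app col_strict_append ?(all_flattenP _ _).1 // cT /=.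
    by rewrite !szTi; move: (r_strip i) (r_strip i.+1); lia.
  + have: all (predC1 0) (flatten (append_max ka n T)).
      apply/all_flattenP => i; rewrite nth_app all_cat all_nseq orbT andbT.
      apply: (all_flattenP _ _).1; apply/allP => x xT /=.
      by apply: contraNneq T0 => <-.
    by move/allP=> A0; apply/negP => /A0.
  + rewrite rev_cons content_rcons rev_n; split.
    * apply/all_flattenP => i; rewrite nth_app all_cat all_nseq leqnn orbT andbT.
      apply: sub_all ((all_flattenP _ _).1 leT i) => x; exact: leqW.
    * by rewrite filter_flatten -/(remove_max _ _) TK.
    * rewrite filter_flatten -/(remove_max _ _) TK !size_flatten shA shT.
      exact: sum_r.
apply: counted_fibers; first exact/filter_uniq/uniq_strips.
  by move=> i j _ _ T [<- _ _ _ _] [<- _ _ _ _].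
by move=> r _; exact: IH.
Qed.

(** * Rows of composition tableaux: removing the entries 1 *)

(** Inverse of [down] once it is known whether the row contains a 1, which is
    then its last entry. *)
Definition up (b : bool) (r : seq nat) : seq nat := map succn r ++ nseq b 1.

Lemma gtn_trans : transitive gtn.
Proof. by move=> y x z /= yx zy; exact: ltn_trans zy yx. Qed.

Lemma up_down r :
  sorted gtn r -> 0 \notin r -> up (1 \in r) (down r) = r.
Proof.
rewrite /up /down; elim: r => //= x r IH sr; rewrite !inE => /norP[x0 r0].
have {}IH := IH (path_sorted sr) r0.
have lt_r : all (ltn^~ x) r.
  by move: sr; rewrite path_sortedE; [case/andP|exact: gtn_trans].
have [lt1x|le_x1] := ltnP 1 x.
  by rewrite /= prednK ?(ltnW lt1x) // (ltn_eqF lt1x) IH.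
have x1 : x = 1 by lia.
suff -> : r = [::] by rewrite x1.
case: r r0 lt_r {IH sr} => // y r; rewrite inE => /norP[y0 _] /=; lia.
Qed.

Lemma downK b r : 0 \notin r -> down (up b r) = r.
Proof.
rewrite /up /down filter_cat map_cat => r0.
have -> : [seq x <- nseq b 1 | 1 < x] = [::] by case: b.
have /all_filterP -> : all (ltn 1) (map succn r).
  by rewrite all_map; apply/allP => -[|x] //= xr; rewrite xr in r0.
by rewrite /= cats0 -map_comp; exact: map_id.
Qed.

Lemma size_up b r : size (up b r) = size r + b.
Proof. by rewrite size_cat size_map size_nseq. Qed.

Lemma nth_up b r k :
  nth 0 (up b r) k =
  if k < size r then (nth 0 r k).+1 else if k == size r then nat_of_bool b else 0.
Proof.
rewrite nth_cat size_map; case: ltnP => lt_k; first by rewrite (nth_map 0).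
rewrite nth_nseq; case: b; case: (ltnP (k - size r));
  case: (eqVneq k (size r)); lia.
Qed.

Definition row_ok (r : seq nat) : bool := sorted gtn r && (0 \notin r).

Lemma row_ok_up b r : row_ok r -> row_ok (up b r).
Proof.
case/andP=> sr r0; apply/andP; split; last first.
  rewrite mem_cat mem_nseq negb_or andbF andbT.
  by apply/mapP => -[].
rewrite (sorted_pairwise gtn_trans) pairwise_cat pairwise_map.
rewrite (sorted_pairwise gtn_trans) in sr.
apply/and3P; split; [|exact: sr|by case: b].
apply/allrelP => _ y /mapP [x xr ->]; rewrite mem_nseq => /andP[_ /eqP ->].
by rewrite /= ltnS lt0n; apply: contraNneq r0 => <-.
Qed.

Lemma row_ok_down r : row_ok r -> row_ok (down r).
Proof.
case/andP=> sr r0; apply/andP; split; last first.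
  by apply/mapP => -[x]; rewrite mem_filter; case: x => [|[]].
rewrite (sorted_pairwise gtn_trans) pairwise_map.
have: pairwise gtn [seq x <- r | 1 < x].
  by apply: pairwise_filter; rewrite -(sorted_pairwise gtn_trans).
apply: sub_in_pairwise (filter_all _ _).
by move=> x y; rewrite !unfold_in /=; lia.
Qed.

Lemma row_nth_gt0 r k : row_ok r -> (0 < nth 0 r k) = (k < size r).
Proof.
case/andP=> _ r0; have [lt_k|ge_k] := ltnP k (size r); last by rewrite nth_default.
by rewrite lt0n; apply: contraNneq r0 => <-; exact: mem_nth.
Qed.

(** The conditions relating row r to a lower row s: the one on the leftmost
    column, and the third one of composition tableaux.  Both also make sense for
    empty rows, which may only occur above the nonempty ones. *)
Definition compatible (r s : seq nat) : bool :=
  (nth 0 r 0 <= nth 0 s 0) &&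
  all (fun k => (nth 0 r k.+1 < nth 0 s k.+1) ==> (nth 0 r k <= nth 0 s k.+1))
      (iota 0 (size s)).

Lemma compatibleP r s :
  reflect (nth 0 r 0 <= nth 0 s 0 /\
           forall k, nth 0 r k.+1 < nth 0 s k.+1 -> nth 0 r k <= nth 0 s k.+1)
          (compatible r s).
Proof.
apply: (iffP andP) => -[le_rs rs]; split=> //.
  move=> k lt_k; have lt_ks : k < size s.
    by case: (ltnP k (size s)) lt_k => // /leqW ge_k; rewrite (nth_default _ ge_k).
  by apply: (implyP (allP rs k _)); rewrite // mem_iota.
by apply/allP => k _; apply/implyP => /rs.
Qed.

(** If r and s have the same length p > 0 and only s receives a 1, that entry
    exceeds the padding 0 in column p of r, yet it is smaller than the entry
    before it, which is at least 2: this is what the third condition forbids.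
    In all other cases the new entries 1 are harmless.  An empty row is present
    only in order to become the row [:: 1], whence the side conditions. *)
Lemma compatible_up b c r s :
  row_ok r -> row_ok s -> (nilp r ==> b) -> (nilp s ==> c) ->
  compatible (up b r) (up c s) = compatible r s && [==> size r == size s, c => b].
Proof.
rewrite /nilp => ok_r ok_s rb sc.
have posr k := row_nth_gt0 k ok_r; have poss k := row_nth_gt0 k ok_s.
apply/compatibleP/andP.
  case=> le0 rs; split; last first.
    apply/implyP => /eqP e; apply/implyP => c1; apply: contraT => b0.
    have r_gt0 : 0 < size r by move: rb b0; case: (size r) => //= ->.
    case Er: (size r) r_gt0 => [//|p] _.
    have := rs p; rewrite !nth_up -e Er c1 (negPf b0) ltnn ltnSn eqxx.
    by move/(_ isT); have := posr p; rewrite Er ltnSn; lia.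
  clear rb sc; apply/compatibleP; split.
    clear rs; move: le0 (posr 0) (poss 0); rewrite !nth_up.
    by case: (size r) => [|m]; case: (size s) => [|p];
      rewrite ?ltn0Sn ?eqxx ?ltnn; case: b; case: c => /=; lia.
  move=> k lt_k; move: {rs le0} (rs k) (posr k) (posr k.+1) (poss k.+1).
  rewrite !nth_up; case: (ltngtP k (size r)); case: (ltngtP k.+1 (size r));
    case: (ltngtP k.+1 (size s)); case: b; case: c => /=; lia.
case=> /compatibleP [le0 rs] bc; split.
  clear rs bc; move: le0 rb sc (posr 0) (poss 0); rewrite !nth_up.
  by case: (size r) => [|m]; case: (size s) => [|p];
      rewrite ?ltn0Sn ?eqxx ?ltnn; case: b; case: c => /=; lia.
move=> k; move: {rs le0} (rs k) (posr k) (posr k.+1) (poss k.+1) bc rb sc.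
clear; rewrite !nth_up.
case: (ltngtP k (size r)); case: (ltngtP k.+1 (size r));
    case: (ltngtP k.+1 (size s)); case: b; case: c => /=; lia.
Qed.

(** * Choosing the rows that receive an entry 1 *)

(** Marks the first m p rows of length p, for every p. *)
Fixpoint mark_top (m : nat -> nat) (G : filling) : seq (bool * seq nat) :=
  if G is r :: G' then
    (0 < m (size r), r) :: mark_top (fun p => m p - (p == size r)) G'
  else [::].

Definition top_first (x y : bool * seq nat) : bool :=
  [==> size x.2 == size y.2, y.1 => x.1].

Definition marked (p : nat) (x : bool * seq nat) : bool :=
  x.1 && (size x.2 == p).

Lemma unzip2_mark_top m G : unzip2 (mark_top m G) = G.
Proof. by elim: G m => //= r G IH m; rewrite IH. Qed.

Lemma mark_top0 m G p : m p = 0 -> ~~ has (marked p) (mark_top m G).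
Proof.
elim: G m => //= r G IH m m0; rewrite negb_or IH ?m0 // andbT /marked /=.
by case: eqP => [->|]; rewrite ?m0 ?andbF.
Qed.

Lemma pairwise_mark_top m G : pairwise top_first (mark_top m G).
Proof.
elim: G m => //= r G IH m; rewrite IH andbT.
have [m0|_] := posnP (m (size r)); last first.
  by apply/allP => x _; rewrite /top_first /= !implybT.
have /hasPn none := @mark_top0 (fun p => m p - (p == size r)) G (size r)
  (congr1 (subn^~ _) m0).
apply/allP => x /none; rewrite /top_first /marked /= [size r == _]eq_sym.
by case: x.1; case: eqP.
Qed.

Lemma count_mark_top m G p :
  m p <= count (fun r => size r == p) G -> count (marked p) (mark_top m G) = m p.
Proof.
elim: G m => [|r G IH] m /=; first by rewrite leqn0 => /eqP ->.
rewrite {1}/marked /= => le_m; rewrite IH; last first.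
  by move: le_m; rewrite [p == _]eq_sym; case: eqP => _; lia.
by rewrite [p == _]eq_sym; case: eqP => [->|_] /=; rewrite ?andbT ?andbF; lia.
Qed.

(** If the first row is not marked then no row of its length is, so the mark of the
    first row is determined by the number of marks for its length. *)
Lemma mark_top_unique m X :
  pairwise top_first X -> (forall p, m p = count (marked p) X) ->
  mark_top m (unzip2 X) = X.
Proof.
elim: X m => //= -[b r] X IH m /andP[/allP bX pX] mX /=.
have none : ~~ b -> count (marked (size r)) X = 0.
  move=> b0; apply/eqP; rewrite -leqn0 leqNgt -has_count; apply/hasPn => x /bX.
  rewrite /top_first /marked /= [size r == _]eq_sym (negPf b0).
  by case: x.1; case: eqP.
have -> : (0 < m (size r)) = b.
  by rewrite mX /marked /= eqxx andbT; case: b {mX IH pX bX} none => //= ->.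
rewrite IH // => p; rewrite mX /marked /= [p == _]eq_sym.
case: eqP => [<-|_]; last by rewrite andbF subn0.
by case: b {mX IH pX bX} none => [_|->] //; rewrite add1n subn1.
Qed.

(** * Composition tableaux: removing the smallest entry *)

(** The length of column k, when the rows of F are left-justified. *)
Definition above (k : nat) (F : filling) : nat := count (ltn k) (shape F).

(** Composition tableaux of content ws whose column lengths are the parts of ka, in
    terms of pairs of rows. *)
Definition rsct_cols (ka ws : seq nat) (F : filling) : Prop :=
  [/\ [::] \notin F, all row_ok F, pairwise compatible F,
      forall k, above k F = nth 0 ka k & content (flatten F) ws].

Definition remove_ones (F : filling) : filling :=
  [seq r <- map down F | ~~ nilp r].

(** The empty rows are the places of the rows [:: 1], which disappear when the
    entries 1 are removed.  They come first and are as many as needed to reach the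
    number of rows prescribed by ka. *)
Definition add_empty_rows (ka : seq nat) (F : filling) : filling :=
  nseq (nth 0 ka 0 - size F) [::] ++ F.

(** Column p has to grow from [above p F] to ka_p, and it grows by the rows of
    length p that receive a 1.  For p = 0 these are all the empty rows. *)
Definition append_ones (ka : seq nat) (F : filling) : filling :=
  [seq up x.1 x.2
     | x <- mark_top (fun p => nth 0 ka p - above p F) (add_empty_rows ka F)].

Lemma above0 F : [::] \notin F -> above 0 F = size F.
Proof.
rewrite /above count_map => F0; apply/eqP; rewrite -all_count.
by apply/allP => r rF /=; rewrite lt0n size_eq0; apply: contraNneq F0 => <-.
Qed.

Lemma aboveS k F :
  above k F = above k.+1 F + count (fun r => size r == k.+1) F.
Proof.
rewrite /above !count_map; elim: F => //= r F ->.
by case: (ltngtP (size r) k.+1) => _ /=; lia.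
Qed.

Lemma above_up k (X : seq (bool * seq nat)) :
  above k [seq up x.1 x.2 | x <- X] = above k (unzip2 X) + count (marked k) X.
Proof.
rewrite /above !count_map; elim: X => //= -[b r] X ->.
rewrite size_up /marked /=; case: b; case: (ltngtP (size r) k) => ? /=; lia.
Qed.

Lemma above_filter k F : above k [seq r <- F | ~~ nilp r] = above k F.
Proof.
rewrite /above !count_map count_filter; apply: eq_count => r /=.
by rewrite /nilp; lia.
Qed.

(** A row below a nonempty row is nonempty, by the leftmost column. *)
Lemma filter_empty_rowsK G :
  pairwise compatible G -> all row_ok G ->
  nseq (size G - size [seq r <- G | ~~ nilp r]) [::]
    ++ [seq r <- G | ~~ nilp r] = G.
Proof.
elim: G => //= r G IH /andP[rG pG] /andP[okr okG].
case: r rG okr => [|x r] rG okr /=.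
  by rewrite subSn ?size_filter ?count_size //= -size_filter IH.
suff /all_filterP -> : all (fun r => ~~ nilp r) G by rewrite subnn.
apply/allP => s sG; have /compatibleP[+ _] := allP rG _ sG.
rewrite /nilp -lt0n -!row_nth_gt0 ?(allP okG) //; apply: leq_trans.
by rewrite row_nth_gt0.
Qed.

Lemma sumn_above n F :
  (forall k, n <= k -> above k F = 0) ->
  sumn (shape F) = \sum_(0 <= k < n) above k F.
Proof.
elim: F => [|r F IH] /= Fn.
  by rewrite big1.
rewrite IH => [|k /Fn]; last by rewrite /above /=; lia.
rewrite /above /= big_split /=; congr (_ + _).
have le_r : size r <= n.
  by have := Fn n (leqnn n); rewrite /above /=; case: ltnP; lia.
rewrite -[LHS](minn_idPl le_r).
elim: n {IH Fn le_r} => [|n IH]; first by rewrite big_nil minn0.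
by rewrite big_nat_recr //= -IH; lia.
Qed.

Lemma flatten_map_down F : flatten (map down F) = down (flatten F).
Proof. by rewrite /down filter_flatten map_flatten -map_comp. Qed.

Lemma flatten_filter_nilp (F : filling) :
  flatten [seq r <- F | ~~ nilp r] = flatten F.
Proof. by elim: F => //= -[|x r] F /= ->. Qed.

Lemma size_flatten_above ka F :
  (forall k, above k F = nth 0 ka k) -> size (flatten F) = sumn ka.
Proof.
move=> kaF; rewrite size_flatten (@sumn_above (size ka)).
  by rewrite (@sumn_nth (size ka)) //; apply: eq_bigr => k _.
by move=> k le_k; rewrite kaF nth_default.
Qed.

Lemma row_ok_flatten F : all row_ok F -> 0 \notin flatten F.
Proof.
elim: F => //= r F IH /andP[/andP[_ r0] /IH F0].
by rewrite mem_cat negb_or r0.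
Qed.

Definition empty_marked (x : bool * seq nat) : bool := nilp x.2 ==> x.1.

Lemma compatible_nil s : compatible [::] s.
Proof. by apply/compatibleP; split=> // k _; rewrite nth_nil. Qed.

Lemma compatible_ups X :
  all row_ok (unzip2 X) -> all empty_marked X ->
  pairwise compatible [seq up x.1 x.2 | x <- X] =
  pairwise compatible (unzip2 X) && pairwise top_first X.
Proof.
rewrite all_map => okX nX; rewrite !pairwise_map -pairwise_relI.
have okn : all (predI (preim snd row_ok) empty_marked) X by rewrite all_predI okX.
apply: eq_in_pairwise okn => -[b r] [c s]; rewrite !unfold_in /= /empty_marked /=.
by case/andP=> okr rb /andP[oks sc]; rewrite compatible_up.
Qed.

Lemma map_down_ups X :
  all row_ok (unzip2 X) -> map down [seq up x.1 x.2 | x <- X] = unzip2 X.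
Proof.
rewrite all_map -map_comp => /allP okX; apply/eq_in_map => x /okX /= /andP[_].
exact: downK.
Qed.

Lemma count_marked_le p X :
  count (marked p) X <= count (fun r => size r == p) (unzip2 X).
Proof. by rewrite count_map; apply: sub_count => x /andP[]. Qed.

Lemma rsct_cols_nil ka : counted (rsct_cols ka [::]) (kostka ka [::]).
Proof.
have F_nil F : rsct_cols ka [::] F -> F = [::].
  case=> F0 okF _ _ /(content_nil (row_ok_flatten okF)) /flatten_nil eF.
  move: F0; rewrite eF.
  by case: (size F) => [|n] //; rewrite inE eqxx.
have [ka0|ka0] := eqVneq (sumn ka) 0; last first.
  exists [::]; rewrite /= (negPf ka0); split=> // F; split=> // rF.
  move: (rF); rewrite (F_nil F rF) => -[_ _ _ /size_flatten_above /= e _].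
  by rewrite -e in ka0.
exists [:: [::]]; rewrite /= ka0; split=> // F; rewrite inE.
split=> [/F_nil -> //|/eqP ->]; split=> // [k|i]; last by rewrite nth_nil.
have /natnseq0P -> : sumn ka == 0 by rewrite ka0.
by rewrite nth_nseq if_same.
Qed.

(** The rows containing a 1 are the topmost of their length, so they are the ones
    that [append_ones] marks. *)
Lemma remove_onesP ka a ws F :
  rsct_cols ka (a :: ws) F ->
  (exists2 r, r \in strips_of ka a & rsct_cols r ws (remove_ones F)) /\
  append_ones ka (remove_ones F) = F.
Proof.
case=> F0 okF gF kaF /(content_cons _ _ (row_ok_flatten okF)) [ctF szF].
pose X := [seq (1 \in r, down r) | r <- F].
have FX : F = [seq up x.1 x.2 | x <- X].
  rewrite -map_comp -[LHS]map_id; apply/eq_in_map => r rF /=.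
  by rewrite up_down //; case/andP: (allP okF r rF).
have GX : unzip2 X = map down F by rewrite /unzip2 -map_comp.
have okG : all row_ok (unzip2 X).
  by rewrite GX all_map; apply: sub_all okF => r; exact: row_ok_down.
have nX : all empty_marked X.
  apply/allP => -[b s] sX; apply/implyP => /= /nilP s0; apply: contraNT F0 => b0.
  by rewrite FX; apply/mapP; exists (b, s); rewrite // s0 (negPf b0).
move: gF; rewrite {1}FX compatible_ups // => /andP[gG tX].
have abF k : above k F = above k (unzip2 X) + count (marked k) X.
  by rewrite {1}FX above_up.
have abP k : above k (remove_ones F) = above k (unzip2 X).
  by rewrite /remove_ones above_filter GX.
have flP : flatten (remove_ones F) = down (flatten F).
  by rewrite flatten_filter_nilp flatten_map_down.
pose r := mkseq (above^~ (remove_ones F)) (size ka).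
have rP k : above k (remove_ones F) = nth 0 r k.
  have [lt_k|ge_k] := ltnP k (size ka); first by rewrite nth_mkseq.
  rewrite [RHS]nth_default ?size_mkseq //.
  by have := abF k; rewrite kaF nth_default // abP; lia.
split; last first.
  rewrite /append_ones [RHS]FX; congr map.
  have -> : add_empty_rows ka (remove_ones F) = unzip2 X.
    rewrite /add_empty_rows -kaF above0 // -(size_map down F) /remove_ones -GX.
    by rewrite filter_empty_rowsK.
  by apply: mark_top_unique => // p; rewrite abP -kaF abF addKn.
exists r.
  rewrite mem_filter -(size_flatten_above kaF) -(size_flatten_above rP).
  rewrite flP szF eqxx; apply/mem_strips; split; first exact: size_mkseq.
  move=> k; rewrite -!kaF -rP abP !abF leq_addr andbT.
  by rewrite [leqRHS]aboveS leq_add2l count_marked_le.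
split=> //.
- by rewrite mem_filter.
- by rewrite all_filter -GX; apply: sub_all okG => s oks; rewrite /= oks implybT.
- by apply: pairwise_filter; rewrite -GX.
- by rewrite flP.
Qed.

(** The strip condition r_p <= ka_p <= r_{p-1} guarantees that there are enough rows
    of length p to receive the prescribed number of entries 1. *)
Lemma append_onesP ka a ws F r :
  r \in strips_of ka a -> rsct_cols r ws F ->
  rsct_cols ka (a :: ws) (append_ones ka F) /\ remove_ones (append_ones ka F) = F.
Proof.
rewrite mem_filter => /andP[/eqP sum_r /mem_strips [szr strip_r]].
case=> F0 okF gF rF ctF.
pose m p := nth 0 ka p - above p F.
pose G := add_empty_rows ka F; pose X := mark_top m G.
have GX : unzip2 X = G by rewrite unzip2_mark_top.
have filG : [seq r <- G | ~~ nilp r] = F.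
  rewrite filter_cat filter_nseq /=; apply/all_filterP/allP => s sF.
  by apply: contraNN F0 => /nilP <-.
have abG k : above k G = above k F by rewrite -above_filter filG.
have cntX p : count (marked p) X = m p.
  apply: count_mark_top; rewrite /m count_cat count_nseq.
  case: p => [|p] /=; first by rewrite mul1n above0 // leq_addr.
  by have := aboveS p F; have := strip_r p; rewrite !rF; lia.
have okG : all row_ok G by rewrite all_cat all_nseq orbT okF.
have nX : all empty_marked X.
  have split0 : count (preim snd (@nilp nat)) X =
      count (marked 0) X + count (predC empty_marked) X.
    elim: X {cntX GX} => //= -[b s] X ->; rewrite /empty_marked /marked /nilp /=.
    by case: b; case: (size s == 0) => /=; lia.
  have nilG : count (preim snd (@nilp nat)) X = m 0.
    rewrite -count_map -/(unzip2 X) GX count_cat count_nseq mul1n /m above0 //.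
    rewrite [count (@nilp nat) F](_ : _ = 0) ?addn0 //; apply/eqP.
    rewrite -leqn0 leqNgt -has_count.
    by apply/hasPn => s sF; apply: contraNN F0 => /nilP <-.
  rewrite all_count -(count_predC empty_marked).
  by move: split0; rewrite nilG cntX; lia.
have flG : pairwise compatible G.
  rewrite pairwise_cat gF andbT; apply/andP; split.
    apply/allrelP => s t; rewrite mem_nseq => /andP[_ /eqP ->] _.
    exact: compatible_nil.
  by elim: (_ - _) => //= d ->; rewrite all_nseq compatible_nil orbT.
have kaX k : above k (append_ones ka F) = nth 0 ka k.
  rewrite above_up -/m -/G -/X GX abG cntX /m rF.
  by have := strip_r k; lia.
have okA : all row_ok (append_ones ka F).
  rewrite all_map; move: okG; rewrite -GX all_map; apply: sub_all => x.
  exact: row_ok_up.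
have rem : remove_ones (append_ones ka F) = F.
  by rewrite /remove_ones map_down_ups -/m -/G -/X GX.
split=> //; split=> //.
- apply/mapP => -[[b s] sX /= /(congr1 size)].
  rewrite size_up /= => /esym/eqP; rewrite addn_eq0 => /andP[s0].
  by move: (allP nX _ sX); rewrite /empty_marked /nilp /= s0 => /= ->.
- by rewrite compatible_ups ?GX // flG pairwise_mark_top.
- apply/content_cons; first exact: row_ok_flatten.
  rewrite -flatten_map_down -flatten_filter_nilp -/(remove_ones _) rem.
  by rewrite (size_flatten_above kaX) (size_flatten_above rF).
Qed.

Lemma rsct_cols_counted ka ws : counted (rsct_cols ka ws) (kostka ka ws).
Proof.
elim: ws ka => [|a ws IH] ka; first exact: rsct_cols_nil.
apply: (counted_bij (peel := remove_ones) (grow := append_ones ka)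
  (B := fun F => exists2 r, r \in strips_of ka a & rsct_cols r ws F)).
- exact: remove_onesP.
- by move=> F [r r_ka rF]; exact: append_onesP rF.
apply: counted_fibers; first exact/filter_uniq/uniq_strips.
  move=> i j; rewrite !mem_filter.
  move=> /andP[_ /mem_strips [szi _]] /andP[_ /mem_strips [szj _]] F.
  case=> _ _ _ iF _ [_ _ _ jF _]; apply: (@eq_from_nth _ 0) => [|k _].
    by rewrite szi szj.
  by rewrite -iF -jF.
by move=> r _; exact: IH.
Qed.

(** * Conjugation and column lengths *)

Lemma geq_trans : transitive geq.
Proof. by move=> y x z /= yx zy; exact: leq_trans zy yx. Qed.

Lemma partition_nth la i : sorted geq la -> nth 0 la i.+1 <= nth 0 la i.
Proof.
move=> /(sortedP 0) sla; have [|ge_i] := ltnP i.+1 (size la); first exact: sla.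
by rewrite nth_default.
Qed.

(** Column j has more than k cells if and only if row k has more than j. *)
Lemma lt_count_ltn la j k :
  sorted geq la -> (k < count (ltn j) la) = (j < nth 0 la k).
Proof.
elim: la k => [|x la IH] k sla; first by rewrite nth_nil.
have /= := sla; rewrite (path_sortedE geq_trans) => /andP[/allP le_x sla'].
have [lt_jx|le_xj] := ltnP j x; first by case: k => [|k] //=; rewrite -IH.
have -> : count (ltn j) la = 0.
  apply/eqP; rewrite -leqn0 leqNgt -has_count; apply/hasPn => y /le_x /=; lia.
case: k => [|k] /=; first by lia.
have [lt_k|ge_k] := ltnP k (size la); last by rewrite nth_default.
by have /= := le_x _ (mem_nth 0 lt_k); lia.
Qed.

Lemma count_ltn_iota m n : count (ltn^~ m) (iota 0 n) = minn m n.
Proof.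
elim: n => [|n IH]; first by rewrite minn0.
by rewrite -addn1 iotaD count_cat IH /=; lia.
Qed.

Lemma leq_bigmax_mem (s : seq nat) x : x \in s -> x <= \max_(p <- s) p.
Proof. by move=> xs; apply: (@leq_bigmax_seq _ s predT id x xs). Qed.

Lemma count_conjugate la k :
  sorted geq la -> count (ltn k) (conjugate la) = nth 0 la k.
Proof.
move=> sla; rewrite count_map.
have le_max : nth 0 la k <= \max_(p <- la) p; last first.
  rewrite -[RHS](minn_idPl le_max) -count_ltn_iota; apply: eq_count => j /=.
  exact: lt_count_ltn.
have [lt_k|ge_k] := ltnP k (size la); last by rewrite nth_default.
exact/leq_bigmax_mem/mem_nth.
Qed.

Lemma conjugate_sorted la : sorted geq (conjugate la).
Proof.
rewrite (sorted_pairwise geq_trans) pairwise_map.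
have := iota_ltn_sorted 0 (\max_(p <- la) p).
rewrite (sorted_pairwise ltn_trans); apply: sub_pairwise => i j /= lt_ij.
by apply: sub_count => p /=; exact: ltn_trans.
Qed.

Lemma conjugate_gt0 la : 0 \notin conjugate la.
Proof.
apply/mapP => -[j]; rewrite mem_iota add0n /= => lt_j /esym/eqP.
rewrite -leqn0 leqNgt -has_count => /hasPn none.
suff: \max_(p <- la) p <= j by rewrite leqNgt lt_j.
by apply/bigmax_leqP_seq => p /none; rewrite -leqNgt.
Qed.

Lemma perm_count_ltn s t :
  0 \notin s -> 0 \notin t ->
  (forall k, count (ltn k) s = count (ltn k) t) -> perm_eq s t.
Proof.
move=> s0 t0 st; apply/allP => -[|x] _ /=.
  by rewrite (count_memPn s0) (count_memPn t0).
have split_count r : count (ltn x) r = count_mem x.+1 r + count (ltn x.+1) r.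
  elim: r => //= y r ->; rewrite [y == _]eq_sym.
    by case: (ltngtP x.+1 y) => ? /=; lia.
apply/eqP/(@addIn (count (ltn x.+1) s)).
by rewrite -split_count !st split_count.
Qed.

(** A multiset of positive integers is determined by the number of its elements
    above each k, and for the conjugate of la these numbers are the parts of
    la. *)
Lemma rearrangementP la al :
  is_partition la ->
  (is_composition al /\ partition_of al = conjugate la) <->
  (0 \notin al /\ forall k, count (ltn k) al = nth 0 la k).
Proof.
case/andP=> _ sla; rewrite /partition_of.
split=> -[al0 alP]; split=> //.
  move=> k; rewrite -count_conjugate // -alP; apply/esym/permP.
  by rewrite perm_sort.
have geq_anti : antisymmetric geq by move=> x y /=; lia.
have geq_total : total geq by move=> x y /=; lia.
rewrite -[RHS](sorted_sort geq_trans (conjugate_sorted la)).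
apply/(perm_sortP geq_total geq_trans geq_anti)/perm_count_ltn => //.
  exact: conjugate_gt0.
by move=> k; rewrite count_conjugate.
Qed.

(** * The tableau conditions in terms of rows *)

Lemma semistandard_ssyt la ws T :
  is_partition la ->
  (semistandard la T /\ content (flatten T) ws) <-> ssyt la ws T.
Proof.
case/andP=> _ sla; split.
  case=> -[shT T0 sT cT] ctT; split=> // i; apply/col_strictP.
  rewrite -!nth_shape shT; split=> [|k lt_k]; first exact: partition_nth.
  apply: cT => //; case: (ltnP i.+1 (size la)) lt_k => // ge_i.
  by rewrite nth_default.
case=> shT sT cT T0 ctT; split=> //; split=> // i k lt_i lt_k.
have /col_strictP [_] := cT i; apply.
by rewrite -nth_shape shT.
Qed.

(** The bound on k in the third condition can be dropped, since entries beyond the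
    longest row are 0; both ordering conditions then concern pairs of rows. *)
Lemma rsct_colsP la ws F :
  (forall k, count (ltn k) (shape F) = nth 0 la k) -> 0 \notin shape F ->
  (rsct (shape F) F /\ content (flatten F) ws) <-> rsct_cols la ws F.
Proof.
move=> laF F0; have nF : [::] \notin F.
  by apply: contraNN F0 => nF; rewrite -[0]/(size (Nil nat)) map_f.
have rows : all row_ok F = (all (sorted gtn) F) && positive_filling F.
  rewrite all_predI; congr (_ && _); rewrite /positive_filling.
  by elim: (F) => //= r G ->; rewrite mem_cat negb_or.
have heads : sorted leq [seq head 0 r | r <- F] =
    pairwise (fun r s => nth 0 r 0 <= nth 0 s 0) F.
  rewrite (sorted_pairwise leq_trans) pairwise_map.
  by apply: eq_pairwise => r s; rewrite /= !nth0.
have compats : pairwise compatible F <-> sorted leq [seq head 0 r | r <- F] /\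
    forall i j k, i < j < size (shape F) -> 0 < k < \max_(a <- shape F) a ->
      entry F j k > entry F i k -> entry F j k >= entry F i k.-1.
  rewrite heads; split.
    move=> gF; split; first by apply: sub_pairwise gF => r s /compatibleP[].
    move=> i j [//|k]; rewrite size_map => /andP[lt_ij lt_j] _.
    have := pairwiseP [::] gF i j; rewrite !inE.
    by move=> /(_ (ltn_trans lt_ij lt_j) lt_j lt_ij) /compatibleP[_]; apply.
  case=> /(pairwiseP [::]) hF cF; apply/(pairwiseP [::]) => i j li lj lt_ij.
  apply/compatibleP; split=> [|k lt_k]; first exact: hF.
  apply: (cF i j k.+1) => //; first by rewrite lt_ij size_map.
  have lt_kj : k.+1 < size (nth [::] F j).
    case: (ltnP k.+1 (size (nth [::] F j))) lt_k => // ge_k.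
    by rewrite (nth_default _ ge_k).
  rewrite /= (leq_trans lt_kj) //; apply: leq_bigmax_mem.
  by apply: map_f; exact: mem_nth.
split.
  case=> -[_ F_pos sF hF cF] ctF; split=> //; first by rewrite rows sF.
  exact/compats.
case=> _; rewrite rows => /andP[sF F_pos] /compats [hF cF] _ ctF.
by split=> //; split.
Qed.

(** * Coefficients of the generating series *)

Local Open Scope classical_set_scope.
Local Open Scope ring_scope.

Lemma generating_series_counted (T : choiceType) (A : set T)
    (wt : T -> exponent) (u : exponent) (m : nat) :
  counted (fun t => A t /\ wt t = u) m -> generating_series A wt u = m%:R.
Proof.
case=> s [Us sP <-]; rewrite /generating_series.
rewrite (fsbigE s) //.
- rewrite big_seq_cond (eq_bigr (fun=> 1)) => [|t /andP[/sP [_ <-] _]]; last first.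
    by rewrite /monomial eqxx.
  rewrite (eq_bigl (mem s)) => [|t]; last first.
    by rewrite andb_idr // => /sP [At _]; exact: mem_set.
  by rewrite -big_seq big_const_seq count_predT -Monoid.iteropE.
- by move=> t /sP [].
- move=> t At ts; rewrite /monomial eq_sym; case: eqP => // wtu.
  by case/negP: ts; apply/sP.
Qed.

(** The support of u is finite, so a finite content determines u once u has no
    exponent on the absent variable x_0. *)
Lemma weight_content (u : exponent) : u 0%N = 0%N ->
  exists ws, forall F : filling, 0%N \notin flatten F ->
    (weight F = u <-> content (flatten F) ws).
Proof.
move=> u0; pose N := \max_(i <- finsupp u) i.
have uN i : (N < i)%N -> u i = 0%N.
  move=> lt_i; apply/eqP; apply: contraTT lt_i => ui.
  by rewrite -leqNgt; apply: leq_bigmax_mem; rewrite mem_finsupp.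
exists (mkseq (fun i => u i.+1) N) => F F0.
have nthN i : nth 0%N (mkseq (fun i => u i.+1) N) i = u i.+1.
  have [lt_i|ge_i] := ltnP i N; first by rewrite nth_mkseq.
  by rewrite nth_default ?size_mkseq // uN.
split=> [wF i|ctF]; first by rewrite nthN -wF weightE.
apply/fsfunP => -[|i]; rewrite weightE ?ctF ?nthN // u0.
exact/count_memPn.
Qed.

Lemma positive_weight_neq (u : exponent) F :
  u 0%N <> 0%N -> 0%N \notin flatten F -> weight F <> u.
Proof. by move=> u0 F0 wF; apply: u0; rewrite -wF weightE; apply/count_memPn. Qed.

(** All shapes on the right-hand side are enumerated at once.  If u involves x_0
    there is no tableau on either side. *)
Lemma coef_enumeration la (u : exponent) : is_partition la ->
  exists2 E : seq filling, uniq E /\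
    (forall F, F \in E <->
      [/\ 0%N \notin shape F, forall k, count (ltn k) (shape F) = nth 0%N la k,
          rsct (shape F) F & weight F = u])
  & schur la u = (size E)%:R.
Proof.
move=> hla; have [u0|/eqP u0] := eqVneq (u 0%N) 0%N; last first.
  exists [::]; first split=> // F.
    by split=> // -[_ _ [_ F0 _ _ _]] /(positive_weight_neq u0 F0).
  apply: generating_series_counted; exists [::]; split=> // T.
  by split=> // -[[_ T0 _ _]] /(positive_weight_neq u0 T0).
have [ws wsP] := weight_content u0.
have [E [UE EP szE]] := rsct_cols_counted la ws.
exists E.
  split=> // F; split.
    move=> /EP rF; have [F0 okF _ laF ctF] := rF.
    have sh0 : 0%N \notin shape F.
      apply/mapP => -[r rF0 /esym/size0nil r0].
      by rewrite r0 in rF0; rewrite rF0 in F0.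
    have [rsF _] := (rsct_colsP ws laF sh0).2 rF.
    by split=> //; exact: (wsP F (row_ok_flatten okF)).2 ctF.
  case=> sh0 laF rsF wF; apply/EP/(rsct_colsP ws laF sh0); split=> //.
  by case: rsF => _ F_pos _ _ _; apply/(wsP _ F_pos).
rewrite szE -kostka_rev; apply: generating_series_counted.
have [s [Us sP <-]] := ssyt_counted la (rev ws).
exists s; split=> // T; rewrite -sP revK -semistandard_ssyt //.
split=> -[ssT]; case: (ssT) => _ T0 _ _ /(wsP _ T0) wT; by split.
Qed.

Theorem mainTheorem4 (la : seq nat) (hla : is_partition la) :
  schur la =
  \sum_(al \in [set al : seq nat |
          is_composition al /\ partition_of al = conjugate la]) RS al.
Proof.
apply/funext => u.
have [E [UE EP] ->] := coef_enumeration u hla.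
have fin := finite_rearrangements (conjugate la).
rewrite fsbig_finite // fct_sumE.
set S := fset_set _.
have memS al : (al \in S) <->
    (0%N \notin al /\ forall k, count (ltn k) al = nth 0%N la k).
  have alP := rearrangementP al hla; rewrite in_fset_set //.
  by split=> [/set_mem /alP|/alP /mem_set].
rewrite (eq_big_seq (fun al => (count (fun F => shape F == al) E)%:R)); last first.
  move=> al /memS [al0 laal]; apply: generating_series_counted.
  exists [seq F <- E | shape F == al]; split; last by rewrite size_filter.
    exact: filter_uniq.
  move=> F; rewrite mem_filter; split.
    case=> rF wF; have shF : shape F = al by case: rF.
    by rewrite shF eqxx; apply/EP; rewrite shF.
  by case/andP=> /eqP <- /EP [].
rewrite -GRing.natr_sum; congr (_%:R).
have ES : {in E, forall F, shape F \in S}.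
  by move=> F /EP [sh0 laF _ _]; apply/memS.
elim: {UE EP} (E) ES => [|F E' IH] ES /=; first by rewrite big1.
rewrite big_split /= -IH => [|G GE]; last by apply: ES; rewrite inE GE orbT.
rewrite (bigD1_seq (shape F)) ?fset_uniq ?ES ?mem_head //= eqxx.
by rewrite big1 ?addn0 // => al; rewrite eq_sym => /negPf ->.
Qed.
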